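(* Let $A$ be an infinite abelian group with restricted $2$-subgroup $E_2$. Then $A$ has a strong complete mapping except, possibly, when $A/E_2$ is finite and has a non-trivial cyclic Sylow $3$-subgroup.
   Context: $A$ is written additively. The restricted $2$-subgroup $E_2$ of $A$ is the subgroup consisting of the identity together with all involutions of $A$ that are not squares (i.e. elements $x$ of order $2$ not of the form $2y$, $y\in A$). A bijection $\theta:A\to A$ is a strong complete mapping if both $x\mapsto\theta(x)-x$ and $x\mapsto x+\theta(x)$ are bijections of $A$.
   Formalization: The identity and the non-square involutions need not form a subgroup (e.g. in Z/4 × (Z/2)^∞, where (0,e)+(2,e)=(2,0) is a square), so E_2 is taken here to be the subgroup they generate; this agrees with the stated E_2 whenever that set is a subgroup. *)

(* Defs.v *)
From HB Require Import structures.
From mathcomp Require Import all_boot all_order all_algebra.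
From mathcomp Require Import generic_quotient ring_quotient.
From mathcomp Require Import all_fingroup all_solvable.
From mathcomp Require Import boolp classical_sets cardinality.
Set Implicit Arguments.
Unset Strict Implicit.
Unset Printing Implicit Defensive.
Import GRing.Theory.
Local Open Scope classical_set_scope.
Local Open Scope ring_scope.

Definition is_subgroup (A : zmodType) (S : set A) : Prop :=
  S 0 /\ (forall x y, S x -> S y -> S (x - y)).

Definition nonsquare_involution (A : zmodType) (x : A) : Prop :=
  [/\ x != 0, x *+ 2 = 0 & ~ exists y : A, x = y *+ 2].

Definition restricted2_set (A : zmodType) : set A :=
  [set x | x = 0 \/ nonsquare_involution x].

Arguments restricted2_set A : clear implicits.

(* [restricted2_set A] need not be closed under addition: in Z/2 x Z/4 the
   elements (1,0) and (1,2) are non-square involutions and their sum (0,2) is a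
   square. The subgroup meant is therefore the one it generates, which is the
   set itself whenever the latter is a subgroup ([restricted2E] below). *)
Definition restricted2 (A : zmodType) : {pred A} :=
  mem (smallest (@is_subgroup A) (restricted2_set A)).

Arguments restricted2 A : clear implicits.

Lemma restricted2E (A : zmodType) : is_subgroup (restricted2_set A) ->
  forall x : A, (x \in restricted2 A) <-> restricted2_set A x.
Proof.
move=> sub x; have -> : restricted2 A = mem (restricted2_set A).
  by rewrite /restricted2 smallest_id.
by split=> [/set_mem|Ex]; [|apply/mem_set].
Qed.

Fact restricted2_zmod_closed (A : zmodType) : zmod_closed (restricted2 A).
Proof.
split=> [|x y /set_mem Sx /set_mem Sy]; apply/mem_set => S [].
  by case.
by move=> subS sS; apply: subS.2; [apply: Sx|apply: Sy].
Qed.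

HB.instance Definition _ (A : zmodType) :=
  GRing.isZmodClosed.Build A (restricted2 A) (restricted2_zmod_closed A).

(* Despite its name, [ideal_quot] is the quotient of a [zmodType] by any
   [zmodClosed] predicate. *)
Definition quotient_E2 (A : zmodType) : zmodType := {ideal_quot (restricted2 A)}.

(* Sylow theory is only available for a [finGroupType], so V, written
   additively, is transported along an isomorphism onto such a group; the
   property does not depend on the isomorphism and entails that V is finite. *)
Definition has_nontrivial_cyclic_Sylow (p : nat) (V : zmodType) : Prop :=
  exists (gT : finGroupType) (f : V -> gT),
    [/\ bijective f,
        {morph f : x y / x + y >-> (x * y)%g} &
        exists P : {group gT},
          [/\ P \in 'Syl_p([set: gT]%SET)%g, P :!=: 1%g & cyclic P]].

Definition strong_complete_mapping (A : zmodType) (theta : A -> A) : Prop :=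
  [/\ bijective theta,
      bijective (fun x => theta x - x) &
      bijective (fun x => x + theta x)].

(* Main.v *)
(* Writing z = theta x - x, a strong complete mapping of a group C amounts to a
   set G of pairs (x, z) on which each of x, z, x + z and z + 2x is a bijection
   onto C. For C countable, G is built by back-and-forth. If 2C is infinite, a
   pair with one prescribed coordinate can be chosen so that the other three
   avoid any finite set. If 2C is finite, fix g : C -> 2C constant on the cosets
   of 2C and with infinite level sets, and use only pairs with 2x = g z: then
   z + 2x = z + g z permutes every coset of 2C automatically, and only three
   coordinates remain.

   Uncountable groups are reached by Zorn's lemma, since strong complete
   mappings of H and of C <= A / H combine into one of the preimage of C that
   extends the one of H. To prevent a maximal H from leaving a finite quotient,
   H is kept disjoint from a fixed countably infinite subgroup K: then A / H
   contains K, and if it is uncountable it has a countably infinite subgroup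
   disjoint from the image of K, which contradicts maximality. *)
Require Import Defs.
From HB Require Import structures.
From mathcomp Require Import all_boot all_order all_algebra.
From mathcomp Require Import generic_quotient ring_quotient.
From mathcomp Require Import all_fingroup all_solvable.
From mathcomp Require Import boolp classical_sets cardinality.
From mathcomp Require Import functions.
Set Implicit Arguments.
Unset Strict Implicit.
Unset Printing Implicit Defensive.
Import GRing.Theory.
Local Open Scope classical_set_scope.
Local Open Scope ring_scope.

(** * Cardinality through fibers, and a back-and-forth construction *)

Lemma finite_fibers (T U : Type) (C : set T) (f : T -> U) :
  finite_set (f @` C) -> (forall u, finite_set (C `&` f @^-1` [set u])) ->
  finite_set C.
Proof.
move=> finfC finfib.
apply: (@sub_finite_set _ _ (\bigcup_(u in f @` C) (C `&` f @^-1` [set u]))).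
  by move=> x Cx; exists (f x) => //; exists x.
exact: bigcup_finite.
Qed.

Lemma countable_fibers (T U : Type) (C : set T) (f : T -> U) :
  countable (f @` C) -> (forall u, countable (C `&` f @^-1` [set u])) ->
  countable C.
Proof.
move=> cfC cfib.
apply: (@sub_countable _ _ _ (\bigcup_(u in f @` C) (C `&` f @^-1` [set u]))).
  apply: subset_card_le => x Cx.
  by exists (f x) => //; exists x.
exact: bigcup_countable.
Qed.

Lemma infinite_avoid (T : Type) (S F : set T) :
  infinite_set S -> finite_set F -> exists2 x, S x & ~ F x.
Proof.
move=> infS finF; have [x [Sx nFx]] := infinite_setN0 (infinite_setD infS finF).
by exists x.
Qed.

Lemma finite_preimage_inj (T U : Type) (f : T -> U) (F : set U) :
  injective f -> finite_set F -> finite_set (f @^-1` F).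
Proof. by move=> finj; apply: finite_preimage => x y _ _ /finj. Qed.

(** Requirements [(i, v)] are coded by naturals and met one at a time along an increasing chain of
    finite sets on which every coordinate is injective; the union is then bijective in every
    coordinate. *)
Lemma back_and_forth (I : finType) (T V : Type) (P : set T)
    (f : I -> T -> V) (C : set V) :
  countable C -> (forall i t, P t -> C (f i t)) ->
  (forall i v (F : set V), C v -> finite_set F ->
    exists t, [/\ P t, f i t = v & forall j, j != i -> ~ F (f j t)]) ->
  exists G : set T, G `<=` P /\ forall i, set_bij G C (f i).
Proof.
move=> /countable_injP[h hinj] fPC ext.
pose inv (L : set T) :=
  [/\ finite_set L, L `<=` P & forall i, {in L &, injective (f i)}].
pose meets (L : set T) n := forall i v, C v -> n = pickle (i, h v) ->
  exists2 t, L t & f i t = v.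
have step (x : {L | inv L} * nat) : exists y : {L | inv L},
    sval x.1 `<=` sval y /\ meets (sval y) x.2.
  case: x => -[L [finL LP Linj]] n /=.
  have [Ln|/existsNP[i /existsNP[v /not_implyP[Cv /not_implyP[En notv]]]]] :=
    pselect (meets L n).
    by exists (exist inv L (And3 finL LP Linj)); split=> [s|].
  have finF : finite_set (\bigcup_j f j @` L).
    by apply: bigcup_finite => [|j _]; [exact: finite_finset|exact: finite_image].
  have [t [Pt ftv tF]] := ext i v _ Cv finF.
  (* Coordinate [i] of [t] is new because the requirement was unmet, the others because they avoid
     [F]. *)
  have ft_new j s : L s -> f j s <> f j t.
    move=> Ls; have [->|ji Efst] := eqVneq j i.
      by rewrite ftv => fsv; apply: notv; exists s.
    by apply: (tF j ji); exists j => //; exists s.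
  have invL : inv (t |` L).
    split=> [|s [->|/LP]//|j s r]; first by rewrite finite_setU.
    rewrite !inE => -[->|Ls] [->|Lr] // Esr.
    - by case: (ft_new j r Lr).
    - by case: (ft_new j s Ls).
    - by apply: (Linj j) => //; apply/mem_set.
  exists (exist inv _ invL); split=> /=; first by move=> s; right.
  move=> j w Cw; rewrite En => /(pcan_inj pickleK)[<- hvw].
  by exists t; [left|rewrite ftv; apply: hinj => //; apply/mem_set].
have [next nextP] := choice step.
have inv0 : inv set0.
  by split=> // j s r; rewrite inE.
pose G_ := fix G_ n := if n is n'.+1 then next (G_ n', n') else exist inv _ inv0.
have G_S n : sval (G_ n) `<=` sval (G_ n.+1) by case: (nextP (G_ n, n)).
have G_mono m n : (m <= n)%N -> sval (G_ m) `<=` sval (G_ n).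
  move=> /subnK <-; elim: (n - m)%N => // k IHk; rewrite addSn.
  exact: subset_trans IHk (G_S _).
exists (\bigcup_n sval (G_ n)); split=> [t [n _]|i].
  by case: (G_ n) => L [finL LP Linj] /=; apply: LP.
split=> [t [n _]|s t|v Cv].
- by case: (G_ n) => L [finL LP Linj] /= /LP; apply: fPC.
- rewrite !inE => -[m _ sm] [n _ tn].
  have {}sm : sval (G_ (maxn m n)) s by apply: G_mono sm; apply: leq_maxl.
  have {}tn : sval (G_ (maxn m n)) t by apply: G_mono tn; apply: leq_maxr.
  by case: (G_ _) sm tn => L [finL LP Linj] /= Ls Lt; apply: Linj; apply/mem_set.
(* Requirement [n] is treated in passing from stage [n] to stage [n + 1], hence the successor
   index. *)
- have [_ /(_ i v Cv erefl)[t tG <-]] := nextP (G_ (pickle (i, h v)), pickle (i, h v)).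
  by exists t => //; exists (pickle (i, h v)).+1.
Qed.

(** * Subgroups represented as sets *)

Section Subgroup.
Variables (A : zmodType) (S : set A).
Hypothesis subS : is_subgroup S.

Lemma subgroup0 : S 0. Proof. by case: subS. Qed.

Lemma subgroupB x y : S x -> S y -> S (x - y).
Proof. by case: subS => _; apply. Qed.

Lemma subgroupN x : S x -> S (- x).
Proof. by move=> Sx; rewrite -sub0r; apply: subgroupB => //; apply: subgroup0. Qed.

Lemma subgroupD x y : S x -> S y -> S (x + y).
Proof. by move=> Sx Sy; rewrite -[y]opprK; apply/subgroupB/subgroupN. Qed.

Lemma subgroupMn x n : S x -> S (x *+ n).
Proof.
move=> Sx; elim: n => [|n IHn]; rewrite ?mulr0n ?mulrS; first exact: subgroup0.
exact: subgroupD.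
Qed.

Lemma subgroup_image (B : zmodType) (f : {additive A -> B}) : is_subgroup (f @` S).
Proof.
split=> [|_ _ [x Sx <-] [y Sy <-]]; first by exists 0; rewrite ?raddf0 //; apply: subgroup0.
by exists (x - y); rewrite ?raddfB //; apply: subgroupB.
Qed.

End Subgroup.

(** * Strong complete mappings of countable subgroups *)

Definition scm_on (A : zmodType) (S : set A) (theta : A -> A) :=
  [/\ set_bij S S theta,
      set_bij S S (fun x => theta x - x) &
      set_bij S S (fun x => x + theta x)].

(** Bijectivity of the first coordinate makes [G] a graph [x -> z]. With [theta x = x + z], the
    other three coordinates are [theta x - x], [theta x] and [x + theta x]. *)
Lemma scm_of_pairs (A : zmodType) (C : set A) (G : set (A * A)) :
  set_bij G C (fun t => t.1) -> set_bij G C (fun t => t.2) ->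
  set_bij G C (fun t => t.1 + t.2) -> set_bij G C (fun t => t.2 + t.1 *+ 2) ->
  exists theta, scm_on C theta.
Proof.
move=> [fun1 inj1 surj1] bij2 bij12 bij112.
have /choice[u uP] x : exists t, t.1 = x /\ (C x -> G t).
  have [Cx|nCx] := pselect (C x); last by exists (x, 0).
  by have [t Gt tx] := surj1 x Cx; exists t.
have u1 x : (u x).1 = x by case: (uP x).
have uG x : C x -> G (u x) by case: (uP x).
have bij_u (c : A * A -> A) : set_bij G C c -> set_bij C C (c \o u).
  move=> [func injc surjc]; split=> [x Cx|x y /set_mem Cx /set_mem Cy /= cxy|v Cv].
  - exact/func/uG.
  - rewrite -(u1 x) -(u1 y); congr (_.1).
    by apply: injc => //; apply/mem_set/uG.
  - have [t Gt <-] := surjc v Cv; exists t.1; first exact: fun1.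
    congr c; apply: inj1; rewrite ?u1 //; apply/mem_set => //.
    exact/uG/fun1.
exists (fun x => x + (u x).2); split.
- rewrite (_ : (fun x => _) = (fun t => t.1 + t.2) \o u); first exact: bij_u.
  by apply/funext => x /=; rewrite u1.
- rewrite (_ : (fun x => _) = (fun t => t.2) \o u); first exact: bij_u.
  by apply/funext => x /=; rewrite addrC addKr.
- rewrite (_ : (fun x => _) = (fun t => t.2 + t.1 *+ 2) \o u); first exact: bij_u.
  by apply/funext => x /=; rewrite u1 addrA -mulr2n addrC.
Qed.

Lemma finite_preimage_addl (A : zmodType) (v : A) (F : set A) :
  finite_set F -> finite_set [set x | F (v + x)].
Proof. exact/finite_preimage_inj/addrI. Qed.

Lemma finite_preimage_subl (A : zmodType) (v : A) (F : set A) :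
  finite_set F -> finite_set [set x | F (v - x)].
Proof. by apply: finite_preimage_inj => x y /addrI/oppr_inj. Qed.

(** Fixing one coordinate leaves one free parameter [y], and the other three are translates of [y],
    [-y], [2y] or [-2y]; since [C] and its double are infinite, all three can avoid a finite set. *)
Lemma countable_subgroup_scm_infinite_double (A : zmodType) (C : set A) :
  is_subgroup C -> countable C ->
  infinite_set ((fun x => x *+ 2) @` C) -> exists theta, scm_on C theta.
Proof.
move=> subC cC infD.
have infC : infinite_set C by apply: contra_not infD; apply: finite_image.
have CB := subgroupB subC; have CD := subgroupD subC; have CM := subgroupMn subC.
have avoid2 v (F : set A) : finite_set F -> exists x, C x /\
    [/\ ~ F x, ~ F (v + x), ~ F (v - x), ~ F (v + x *+ 2) & ~ F (v - x *+ 2)].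
  move=> finF.
  (* If [2x] is not the double of a point of [F] or [W], then [x] lies in neither; if moreover [2x]
     is outside [W], then [v + 2x] and [v - 2x] avoid [F]. *)
  pose W := [set x | F (v + x)] `|` [set x | F (v - x)].
  have finW : finite_set W.
    rewrite finite_setU; split.
      exact: finite_preimage_addl.
    exact: finite_preimage_subl.
  have finU : finite_set ((fun x => x *+ 2) @` (F `|` W) `|` W).
    by rewrite finite_setU; split=> //; apply: finite_image; rewrite finite_setU.
  have [_ [x Cx <-] nU] := infinite_avoid infD finU.
  exists x; split=> //; split=> Fx; apply: nU.
  - by left; exists x => //; left.
  - by left; exists x => //; right; left.
  - by left; exists x => //; right; right.
  - by right; left.
  - by right; right.
pose f (i : bool * bool) (t : A * A) := match i with
  | (false, false) => t.1 | (false, true) => t.2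
  | (true, false) => t.1 + t.2 | (true, true) => t.2 + t.1 *+ 2 end.
have [|[x z] v F Cv finF|G [_ Gbij]] := @back_and_forth _ _ _ (C `*` C) f C cC.
- by move=> [[] []] [x z] [/= Cx Cz] //; [apply/CD => //; apply: CM|apply: CD].
- have [y [Cy [F1 F2 F3 F4 F5]]] := avoid2 v F finF.
  case: x z => [] [].
  + exists (y, v - y *+ 2); split=> /=; first by split=> //; apply/CB/CM.
      by rewrite subrK.
    by move=> [[] []] //= _; rewrite mulr2n opprD addrCA addNKr.
  + exists (y, v - y); split=> /=; first by split=> //; apply/CB.
      by rewrite addrC subrK.
    by move=> [[] []] //= _; rewrite mulr2n addrA subrK.
  + exists (y, v); split=> // -[[] []] //= _.
    by rewrite addrC.
  (* With [x = v] fixed, the parameter is [z], which is never doubled, so infinitude of [C]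
     suffices. *)
  + have fin3 : finite_set (F `|` [set z | F (v + z)] `|` [set z | F (v *+ 2 + z)]).
      by rewrite !finite_setU; split; [split=> //|]; apply: finite_preimage_addl.
    have [z Cz nF] := infinite_avoid infC fin3.
    exists (v, z); split=> // -[[] []] //= _ Fz; apply: nF.
    * by right; rewrite /= addrC.
    * by left; right.
    * by left; left.
- exact: (scm_of_pairs (Gbij (false, false)) (Gbij (false, true))
    (Gbij (true, false)) (Gbij (true, true))).
Qed.

Lemma infinite_sequence (T : Type) (R : set T) : infinite_set R ->
  exists e : nat -> T, injective e /\ forall n, R (e n).
Proof.
elim/Ppointed: T => T in R *.
  by rewrite emptyE => infR; case: infR; apply: finite_set0.
move=> /infiniteP/pcard_leP[f]; exists f; split=> [m n|n]; first by apply: inj; rewrite inE.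
exact: funS.
Qed.

(** An injective sequence in [R] is split by a pairing into one infinite subsequence per [d]; points
    on none of them get the default [d0]. *)
Lemma infinite_level_sets (T : Type) (U : choiceType) (R : set T) (D : set U) (d0 : U) :
  infinite_set R -> countable D -> D d0 ->
  exists H : T -> U, (forall x, D (H x)) /\
    forall d, D d -> infinite_set (R `&` H @^-1` [set d]).
Proof.
move=> infR /countable_injP[h hinj] Dd0.
have [e [einj eR]] := infinite_sequence infR.
pose below x := [set d | D d /\ exists k : nat, x = e (pickle (h d, k))].
exists (fun x => xget d0 (below x)); split=> [x|d Dd].
  by case: xgetP => // d _ [].
have kinj : injective (fun k : nat => e (pickle (h d, k))).
  by move=> k l /einj/(pcan_inj pickleK)[].
apply: (@sub_infinite_set _ (range (fun k : nat => e (pickle (h d, k))))).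
  move=> _ [k _ <-]; split; first exact: eR.
  apply: xget_unique; first by split=> //; exists k.
  move=> c [Dc [l /einj/(pcan_inj pickleK)[hcd _]]].
  by apply: hinj; rewrite ?inE.
by move/(finite_preimage_inj kinj); rewrite preimage_range; apply: infinite_nat.
Qed.

Lemma countable_subgroup_scm_finite_double (A : zmodType) (C : set A) :
  is_subgroup C -> countable C -> infinite_set C ->
  finite_set ((fun x => x *+ 2) @` C) -> exists theta, scm_on C theta.
Proof.
move=> subC cC infC; set D := _ @` C => finD.
have CB := subgroupB subC; have CD := subgroupD subC; have CM := subgroupMn subC.
have DB x y : D x -> D y -> D (x - y).
  by move=> [u Cu <-] [v Cv <-]; exists (u - v); [apply: CB|rewrite mulrnBl].
have DD x y : D x -> D y -> D (x + y).
  by move=> [u Cu <-] [v Cv <-]; exists (u + v); [apply: CD|rewrite mulrnDl].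
have D0 : D 0 by exists 0; [apply: subgroup0|rewrite mul0rn].
have DC : D `<=` C by move=> _ [x Cx <-]; apply: CM.
pose E := [set x | C x /\ x *+ 2 = 0].
(* Nonempty fibers of doubling on [C] are translates of [E], and there are finitely many of them. *)
have infE : infinite_set E.
  move=> finE; apply: infC; apply: (finite_fibers finD) => u.
  have [->|/set0P[x [Cx xu]]] := eqVneq (C `&` (fun x => x *+ 2) @^-1` [set u]) set0 => //.
  apply: sub_finite_set (finite_preimage_addl (- x) finE) => y [Cy yu].
  split; first by rewrite addrC; apply: CB.
  by rewrite mulrnDl mulNrn xu yu addNr.
(* Representatives of the cosets of D meeting E, taken inside E, where doubling
   vanishes; rep is 0 on the other cosets. *)
pose rep z := xget 0 [set w | E w /\ D (w - z)].
have rep_eq y z : D (y - z) -> rep y = rep z.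
  move=> Dyz; congr xget; apply/seteqP; split=> w [Ew Dw]; split=> //.
    by rewrite -(subrK y w) -addrA; apply: DD.
  by rewrite -(subrK z w) -addrA -[z - y]opprB; apply: DB.
have repP z : E z -> E (rep z) /\ D (rep z - z).
  by move=> Ez; apply: (@xgetI _ 0 [set w | E w /\ D (w - z)] z); split; rewrite ?subrr.
pose R := rep @` E.
have infR : infinite_set R.
  apply: contra_not infE => finR; apply: (finite_fibers finR) => u.
  apply: sub_finite_set (finite_preimage_subl u finD) => z [Ez <-] /=.
  by case: (repP z Ez).
have RE r : R r -> [/\ C r, r *+ 2 = 0 & rep r = r].
  move=> [z Ez <-]; have [[Cr r0] Dr] := repP z Ez.
  by split=> //; apply: rep_eq.
have [H [HD Hinf]] := infinite_level_sets infR (finite_set_countable finD) D0.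
pose g z := H (rep z).
have g_eq y z : D (y - z) -> g y = g z by move=> /rep_eq; rewrite /g => ->.
have gC z : C (g z) by apply/DC/HD.
pose P := [set t : A * A | [/\ C t.1, C t.2 & t.1 *+ 2 = g t.2]].
pose f (i : option bool) (t : A * A) := match i with
  | None => t.2 | Some false => t.1 | Some true => t.1 + t.2 end.
(* [R] consists of 2-torsion elements fixed by [rep], so there [g] agrees with [H] and takes each
   value in [D] infinitely often. *)
have avoid v c (F : set A) : D c -> finite_set F ->
    exists r, [/\ C r, r *+ 2 = 0, g r = c & [/\ ~ F r, ~ F (v + r) & ~ F (v - r)]].
  move=> Dc finF.
  have finU : finite_set (F `|` [set r | F (v + r)] `|` [set r | F (v - r)]).
    rewrite !finite_setU; split; last exact: finite_preimage_subl.
    by split=> //; exact: finite_preimage_addl.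
  have [r [Rr Hr] nF] := infinite_avoid (Hinf c Dc) finU.
  have [Cr r0 rep_r] := RE r Rr; exists r; split=> //; first by rewrite /g rep_r.
  by split=> Fr; apply: nF; [left; left|left; right|right].
have [i [x z] [/= Cx Cz _]|i v F Cv finF|G [GP Gbij]] :=
    @back_and_forth _ _ _ P f C cC.
- by case: i => [[]|] //=; apply: CD.
- case: i => [[]|].
  (* With [z = r] of 2-torsion, [x = v - r] has double [2v], which is thus the value required of
     [g r]. *)
  + have [|r [Cr r0 gr [F1 F2 F3]]] := avoid v (v *+ 2) F _ finF; first by exists v.
    exists (v - r, r); split=> /=; first by split; rewrite ?mulrnBl ?r0 ?gr ?subr0 //; apply: CB.
      by rewrite subrK.
    by move=> [[]|].
  + have [|r [Cr r0 gr [F1 F2 F3]]] := avoid v (v *+ 2) F _ finF; first by exists v.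
    exists (v, r); split=> //=.
    by move=> [[]|].
  (* Since [2y = g v], adding elements of [E] to [y] gives infinitely many admissible first
     coordinates. *)
  + have [y Cy yg] := HD (rep v).
    have finU : finite_set ([set x | F (y + x)] `|` [set x | F (y + v + x)]).
      by rewrite finite_setU; split; exact: finite_preimage_addl.
    have [x [Cx x0] nF] := infinite_avoid infE finU.
    exists (y + x, v); split=> //=.
      by split=> //; [apply: CD|rewrite mulrnDl x0 addr0].
    by move=> [[]|] //= _ Fx; apply: nF; [right; rewrite /= addrAC|left].
- have [fun2 inj2 surj2] := Gbij None.
  apply: (scm_of_pairs (Gbij (Some false)) (Gbij None) (Gbij (Some true))).
  (* On [G] the last coordinate is [z + g z]. Equal values put both [z] in one coset of [D], where
     [g] is constant; the value [v] comes from [z = v - g v]. *)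
  split=> [t /GP [Ct1 Ct2 _]|s t Gs Gt|v Cv].
  + by apply/CD => //; apply: CM.
  + have [Cs1 Cs2 ->] := GP s (set_mem Gs); have [Ct1 Ct2 ->] := GP t (set_mem Gt).
    move=> Est; apply: inj2 => //=.
    suff /g_eq gst : D (s.2 - t.2) by move: Est; rewrite gst => /addIr.
    rewrite (_ : s.2 - t.2 = g t.2 - g s.2); first by apply: DB; apply: HD.
    by apply/eqP; rewrite subr_eq addrAC eq_sym subr_eq addrC -Est.
  + have [t Gt tE] := surj2 (v - g v) (CB _ _ Cv (gC v)).
    exists t => //; have [_ _ ->] := GP t Gt.
    have /g_eq -> : D (t.2 - v) by rewrite [t.2]tE addrAC subrr; apply: DB => //; apply: HD.
    by rewrite [t.2]tE subrK.
Qed.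

Lemma countable_subgroup_scm (A : zmodType) (C : set A) :
  is_subgroup C -> countable C -> infinite_set C -> exists theta, scm_on C theta.
Proof.
move=> subC cC infC.
have [finD|infD] := pselect (finite_set ((fun x => x *+ 2) @` C)).
  exact: countable_subgroup_scm_finite_double.
exact: countable_subgroup_scm_infinite_double.
Qed.

(** * Countable subgroups and quotients *)

(** Lists of pairs index the finite sums of differences of a sequence. There are countably many, and
    swapping each pair negates the sum. *)
Lemma exists_countable_subgroup (A : zmodType) (S : set A) :
  is_subgroup S -> infinite_set S ->
  exists C : set A, [/\ C `<=` S, is_subgroup C, countable C & infinite_set C].
Proof.
move=> subS /infinite_sequence[e [einj eS]].
pose s (l : seq (nat * nat)) := \sum_(p <- l) (e p.1 - e p.2).
exists (range s); split.
- move=> _ [l _ <-]; rewrite /s; elim: l => [|p l IHl].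
    by rewrite big_nil; apply: subgroup0.
  by rewrite big_cons; apply: subgroupD => //; apply: subgroupB.
- split=> [|_ _ [l _ <-] [m _ <-]]; first by exists [::]; rewrite // /s big_nil.
  exists (l ++ [seq (p.2, p.1) | p <- m]) => //.
  rewrite /s big_cat big_map -sumrN /=; congr (_ + _).
  by apply: eq_bigr => p _; rewrite opprB.
- exact: card_le_trans (card_image_le _ _) (countableP _).
- have einj0 : injective (fun n => e n - e 0%N) by move=> m n /addIr/einj.
  apply: (@sub_infinite_set _ (range (fun n => e n - e 0%N))).
    by move=> _ [n _ <-]; exists [:: (n, 0%N)]; rewrite // /s big_seq1.
  by move/(finite_preimage_inj einj0); rewrite preimage_range; apply: infinite_nat.
Qed.

(** The proof argument lets the closure instance recover [is_subgroup H] from the predicate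
    itself. *)
Definition subgroup_pred (A : zmodType) (H : set A) of is_subgroup H : {pred A} :=
  mem H.

Fact subgroup_pred_zmod_closed (A : zmodType) (H : set A) (subH : is_subgroup H) :
  zmod_closed (subgroup_pred subH).
Proof.
split=> [|x y /set_mem Hx /set_mem Hy]; apply/mem_set; first exact: subgroup0.
exact: subgroupB.
Qed.

HB.instance Definition _ (A : zmodType) (H : set A) (subH : is_subgroup H) :=
  GRing.isZmodClosed.Build A (subgroup_pred subH) (subgroup_pred_zmod_closed subH).

Lemma quotient_by_subgroup (A : zmodType) (H : set A) : is_subgroup H ->
  exists (Q : zmodType) (pi : {additive A -> Q}),
    (forall q, exists x, pi x = q) /\ forall x, pi x = 0 <-> H x.
Proof.
move=> subH; pose Q : zmodType := {ideal_quot (subgroup_pred subH)}.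
exists Q, (\pi_({ideal_quot (subgroup_pred subH)})%qT : {additive A -> Q}).
split=> [q|x]; first by elim/quotW: q => x; exists x.
rewrite -(raddf0 (\pi_({ideal_quot (subgroup_pred subH)})%qT : {additive A -> Q})).
split=> [/eqP|Hx]; [|apply/eqP]; rewrite -Quotient.idealrBE subr0.
  by move/set_mem.
exact/mem_set.
Qed.

(** * Extending a mapping along a quotient *)

Section Extension.
Variables (A Q : zmodType) (pi : {additive A -> Q}) (H : set A) (C : set Q).
Hypothesis piH : forall x, pi x = 0 <-> H x.

(** With [x = r (pi x) + h] and [h] in [H], the map permutes cosets by [pi \o rho] and acts inside
    each one through a translate of [beta]. *)
Lemma coset_set_bij (r rho : Q -> A) (beta : A -> A) :
  cancel r pi -> set_bij C C (pi \o rho) -> set_bij H H beta ->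
  set_bij (pi @^-1` C) (pi @^-1` C)
    (fun x => rho (pi x) + beta (x - r (pi x))).
Proof.
move=> rK [funr injr surjr] [funb injb surjb].
have hH x : H (x - r (pi x)) by apply/piH; rewrite raddfB /= rK subrr.
have piF x : pi (rho (pi x) + beta (x - r (pi x))) = (pi \o rho) (pi x).
  by rewrite raddfD /= (iffRL (piH (beta _))) ?addr0 //; apply: funb.
split=> [x /= Cx|x y /set_mem /= Cx /set_mem /= Cy Exy|v /= Cv].
- by rewrite piF; apply: funr.
- have pixy : pi x = pi y by apply: injr; rewrite ?inE // -!piF Exy.
  move: Exy; rewrite pixy => /addrI bxy; apply: (@addIr _ (- r (pi y))).
  by apply: injb => //; apply/mem_set => //; rewrite -pixy; apply: hH.
- have [q Cq piq] := surjr _ Cv.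
  have Hv : H (v - rho q) by apply/piH; rewrite raddfB /= -piq subrr.
  have [h Hh hv] := surjb _ Hv; have piqh : pi (r q + h) = q.
    by rewrite raddfD /= rK (iffRL (piH h)) ?addr0.
  by exists (r q + h); rewrite /= piqh // [r q + h]addrC addrK hv addrC subrK.
Qed.

Lemma scm_on_extension (theta : A -> A) (phi : Q -> Q) :
  (forall q, exists x, pi x = q) -> is_subgroup C ->
  scm_on H theta -> scm_on C phi ->
  exists theta', scm_on (pi @^-1` C) theta' /\
    forall x, H x -> theta' x = theta x.
Proof.
move=> /choice[r0 r0K] subC [th thB thD] [ph phB phD].
have CB := subgroupB subC; have CD := subgroupD subC; have C0 := subgroup0 subC.
have Cphi0 : C (phi 0) by case: ph => + _ _; apply.
(* The section is normalized at 0 so that [x - r (pi x)] is [x] itself when [x] is in [H]. *)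
have [r [rK r00]] : exists r, cancel r pi /\ r 0 = 0.
  by exists (fun q => r0 q - r0 0); split=> [q|]; rewrite ?raddfB /= ?r0K ?subr0 ?subrr.
have shift (f g : Q -> Q) : set_bij C C f -> (forall q, g q = f q - phi 0) ->
    set_bij C C g.
  move=> [funf injf surjf] gE; split=> [q Cq|p q Cp Cq|q Cq]; rewrite ?gE.
  - exact/CB/Cphi0/funf.
  - by move=> /addIr; apply: injf.
  - have [p Cp pq] := surjf _ (CD _ _ Cq Cphi0).
    by exists p; rewrite // gE pq addrK.
(* Subtracting phi 0 makes the new mapping agree with theta on H. *)
exists (fun x => r (phi (pi x) - phi 0) + theta (x - r (pi x))); split; first split.
- apply: (coset_set_bij (rho := fun q => r (phi q - phi 0)) rK _ th).
  by apply: shift ph _ => q /=; rewrite rK.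
- rewrite (_ : (fun x => _) = fun x => (r (phi (pi x) - phi 0) - r (pi x)) +
      (theta (x - r (pi x)) - (x - r (pi x)))); last first.
    by apply/funext => x; rewrite opprB addrACA addKr.
  apply: (coset_set_bij (rho := fun q => r (phi q - phi 0) - r q)
    (beta := fun h => theta h - h) rK _ thB).
  by apply: shift phB _ => q /=; rewrite raddfB /= !rK addrAC.
- rewrite (_ : (fun x => _) = fun x => (r (pi x) + r (phi (pi x) - phi 0)) +
      (x - r (pi x) + theta (x - r (pi x)))); last first.
    by apply/funext => x; rewrite addrACA [r _ + (x - _)]addrC subrK.
  apply: (coset_set_bij (rho := fun q => r q + r (phi q - phi 0))
    (beta := fun h => h + theta h) rK _ thD).
  by apply: shift phD _ => q /=; rewrite raddfD /= !rK addrA.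
- by move=> x /piH ->; rewrite subrr r00 add0r subr0.
Qed.

End Extension.

(** * Subgroups of uncountable groups that avoid a countable one *)

Lemma countable_mulrn_preimage (A : zmodType) (n : nat) (L : set A) :
  countable L -> countable [set x : A | x *+ n = 0] ->
  countable [set x | L (x *+ n)].
Proof.
move=> cL cker; apply: (@countable_fibers _ _ _ (fun x => x *+ n)) => [|u].
  by apply: sub_countable cL; apply: subset_card_le => _ [x Lx <-].
have [->|/set0P[x [_ /= <-]]] :=
    eqVneq ([set x | L (x *+ n)] `&` (fun x => x *+ n) @^-1` [set u]) set0.
  exact: countable0.
apply: (@sub_countable _ _ _ ((fun y => x + y) @` [set y | y *+ n = 0])).
  apply: subset_card_le => y [_ /= yx].
  by exists (y - x); rewrite /= ?mulrnBl ?yx ?subrr // addrC subrK.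
exact: sub_countable (card_image_le _ _) cker.
Qed.

(* The least n for which the n-torsion is uncountable, if any, is prime, so that
   any n-torsion element outside L will do; otherwise the elements having a
   nonzero multiple in L form a countable set. *)
Lemma uncountable_disjoint_cycle (A : zmodType) (L : set A) :
  ~ countable [set: A] -> is_subgroup L -> countable L ->
  exists2 c : A, c != 0 & forall n, L (c *+ n) -> c *+ n = 0.
Proof.
move=> uncA subL cL; apply: contrapT => noc.
pose T n := [set x : A | x *+ n = 0].
pose uncT n := (0 < n)%N && `[< ~ countable (T n) >].
have exT : exists n, uncT n.
  apply: contrapT => /forallNP cT; apply: uncA.
  have {}cT n : (0 < n)%N -> countable (T n).
    by move=> n0; apply: contrapT => uT; apply: (cT n); rewrite /uncT n0; apply/asboolP.
  apply: (@sub_countable _ _ _ (\bigcup_(n in [set n | (0 < n)%N]) [set x | L (x *+ n)])).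
    apply: subset_card_le => x _; have [->|x0] := eqVneq x 0.
      by exists 1%N; rewrite /= ?mul0rn //; apply: subgroup0.
    have [n /not_implyP[Ln xn]] : exists n, ~ (L (x *+ n) -> x *+ n = 0).
      by apply/existsNP => xL; apply: noc; exists x.
    by exists n => //=; case: n xn {Ln} => //; rewrite mulr0n.
  apply: bigcup_countable => [|n /= n0]; first exact: countableP.
  exact/countable_mulrn_preimage/cT.
have [n /andP[n0 /asboolP uT] min_n] := ex_minnP exT.
have cT m : (0 < m)%N -> (m < n)%N -> countable (T m).
  move=> m0; rewrite ltnNge => /negP mn; apply: contrapT => um.
  by apply/mn/min_n; rewrite /uncT m0; apply/asboolP.
have n1 : (1 < n)%N.
  rewrite ltn_neqAle n0 andbT; apply/eqP => En; apply: uT; rewrite -En.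
  rewrite (_ : T 1%N = [set 0]); first exact: countable1.
  by apply/seteqP; split=> x; rewrite /T /= mulr1n.
have n_prime : prime n.
  have [pn|pn] := ltnP (pdiv n) n; last first.
    rewrite (_ : n = pdiv n) ?pdiv_prime //.
    by apply/eqP; rewrite eqn_leq pn pdiv_leq.
  (* For [p = pdiv n], the [n]-torsion is the preimage of the [n / p]-torsion under multiplication
     by [p], whose kernel is countable when [p < n]. *)
  case: uT; have p0 := pdiv_gt0 n.
  have cTq : countable (T (n %/ pdiv n)%N).
    apply: cT; first by rewrite divn_gt0 // pdiv_leq.
    by rewrite ltn_Pdiv // prime_gt1 ?pdiv_prime.
  have := countable_mulrn_preimage cTq (cT _ p0 pn); congr countable.
  by apply/seteqP; split=> x; rewrite /T /= -mulrnA mulnC divnK ?pdiv_dvd.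
have [c /not_implyP[cn Lc]] : exists c, ~ (T n c -> L c).
  apply/existsNP => TL; apply: uT; apply: sub_countable cL.
  exact: subset_card_le.
apply: noc; exists c => [|k Lk].
  by apply: contra_notN Lc => /eqP ->; apply: subgroup0.
have [/dvdnP[q ->]|ndvd] := boolP (n %| k)%N; first by rewrite mulnC mulrnA cn mul0rn.
(* Bezout gives [1 + a * k] divisible by [n], so [c] is minus [a] times [c *+ k] and would lie in
   [L]. *)
case: Lc; have [a _] := Bezoutl k n0.
move: ndvd; rewrite -prime_coprime // /coprime => /eqP -> /dvdnP[b Eb].
have : c *+ (1 + a * k) = 0 by rewrite Eb mulnC mulrnA cn mul0rn.
rewrite mulrnDr mulr1n mulnC mulrnA => /eqP; rewrite addr_eq0 => /eqP ->.
by apply: (subgroupN subL); apply: subgroupMn.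
Qed.

(** A maximal subgroup [M] meeting [K] trivially is infinite: were it finite, [M + K] would be
    countable, and a nonzero cyclic group meeting it trivially could be added to [M]. *)
Lemma uncountable_disjoint_subgroup (A : zmodType) (K : set A) :
  ~ countable [set: A] -> is_subgroup K -> countable K ->
  exists C : set A, [/\ is_subgroup C, countable C, infinite_set C &
    forall x, C x -> K x -> x = 0].
Proof.
move=> uncA subK cK.
(* Not is_subgroup: P must also hold of the empty set, the union of the empty
   chain. *)
pose P (M : set A) := (forall x y, M x -> M y -> M (x - y)) /\
  forall x, M x -> K x -> x = 0.
have [F FP Ftot|M [[MB MK] Mmax]] := @Zorn_bigcup _ P.
  split=> [x y [M FM Mx] [N FN Ny]|x [M FM Mx]]; last by have [_] := FP M FM; apply.
  have [MN|NM] := Ftot M N FM FN.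
    by exists N => //; have [NB _] := FP N FN; apply: NB => //; apply: MN.
  by exists M => //; have [MB _] := FP M FM; apply: MB => //; apply: NM.
have M0 : M 0.
  apply: contrapT => nM0; apply: (Mmax [set 0]); last first.
    by split=> [x y -> ->|x -> //]; rewrite /= subrr.
  split=> [x Mx|/(_ 0 erefl)//]; case: nM0; rewrite -(subrr x); exact: MB.
have subM : is_subgroup M by [].
have [finM|infM] := pselect (finite_set M); last first.
  have [C [CM subC cC infC]] := exists_countable_subgroup subM infM.
  by exists C; split=> // x /CM; apply: MK.
have MD := subgroupD subM; have KB := subgroupB subK.
pose L := [set x | exists m, M m /\ K (x - m)].
have subL : is_subgroup L.
  split=> [|x y [m [Mm Km]] [n [Mn Kn]]].
    by exists 0; split=> //; rewrite subrr; apply: subgroup0.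
  exists (m - n); split; first exact: MB.
  by rewrite opprB [n - m]addrC addrACA [- y + n]addrC -[n - y]opprB; apply: KB.
have cL : countable L.
  have cMK := countableX (finite_set_countable finM) cK.
  apply: (@sub_countable _ _ _ ((fun t => t.1 + t.2) @` (M `*` K))); last first.
    exact: sub_countable (card_image_le _ _) cMK.
  apply: subset_card_le => x [m [Mm Km]].
  by exists (m, x - m) => //=; rewrite addrC subrK.
have [c c0 cL0] := uncountable_disjoint_cycle uncA subL cL.
have czL z : L (c *~ z) -> c *~ z = 0.
  case: z => n; first exact: cL0.
  by rewrite NegzE mulrNz -pmulrn => /(subgroupN subL); rewrite opprK => /cL0 ->; rewrite oppr0.
pose N := [set x | exists z : int, M (x - c *~ z)].
exfalso; apply: (Mmax N).
  split=> [x Mx|NM]; first by exists 0; rewrite mulr0z subr0.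
  have Mc : M c by apply: NM; exists 1; rewrite mulr1z subrr.
  move/eqP: c0; apply; rewrite -[c]mulr1n; apply: cL0; rewrite mulr1n.
  by exists c; split=> //; rewrite subrr; apply: subgroup0.
split=> [x y [z Mx] [w My]|x [z Mx] Kx].
  exists (z - w); rewrite mulrzBr opprB [_ - c *~ z]addrC addrACA [- y + _]addrC.
  by rewrite -[_ - y]opprB; apply: MB.
(* As [x] is in [K] and [x - c *~ z] in [M], the multiple [c *~ z] lies in [L], which is [M + K]. *)
have cz0 : c *~ z = 0.
  apply: czL; exists (- (x - c *~ z)); split; first exact: subgroupN.
  by rewrite opprK addrC subrK.
by apply: MK => //; move: Mx; rewrite cz0 subr0.
Qed.

(** * Maximal partial mappings *)

Lemma eq_scm_on (A : zmodType) (S : set A) (theta theta' : A -> A) :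
  (forall x, S x -> theta' x = theta x) -> scm_on S theta -> scm_on S theta'.
Proof.
have eq_bij (f g : A -> A) : (forall x, S x -> g x = f x) ->
    set_bij S S f -> set_bij S S g.
  move=> gf [funf injf surjf]; split=> [x Sx|x y Sx Sy|y Sy].
  - by rewrite gf //; apply: funf.
  - by rewrite !gf; [apply: injf|apply/set_mem|apply/set_mem].
  - by have [x Sx <-] := surjf y Sy; exists x; rewrite ?gf.
move=> eqt [t tB tD]; split.
- exact: eq_bij t.
- by apply: eq_bij tB => x /eqt ->.
- by apply: eq_bij tD => x /eqt ->.
Qed.

Lemma set_bij_chain_bigcup (I T : Type) (D : set I) (F : I -> set T) (f : T -> T) :
  (forall i j, D i -> D j -> F i `<=` F j \/ F j `<=` F i) ->
  (forall i, D i -> set_bij (F i) (F i) f) ->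
  set_bij (\bigcup_(i in D) F i) (\bigcup_(i in D) F i) f.
Proof.
move=> Ftot Fbij; split=> [x [i Di Fx]|x y|y [i Di Fy]].
- by exists i => //; have [funf _ _] := Fbij i Di; apply: funf.
- move=> /set_mem[i Di Fx] /set_mem[j Dj Fy].
  have [ij|ji] := Ftot i j Di Dj.
    by have [_ injf _] := Fbij j Dj; apply: injf; apply/mem_set => //; apply: ij.
  by have [_ injf _] := Fbij i Di; apply: injf; apply/mem_set => //; apply: ji.
- have [_ _ surjf] := Fbij i Di; have [x Fx <-] := surjf y Fy.
  by exists x => //; exists i.
Qed.

Lemma scm_on_set0 (A : zmodType) : scm_on [set 0 : A] id.
Proof.
have bij0 (f : A -> A) : f 0 = 0 -> set_bij [set 0] [set 0] f.
  move=> f0; split=> [x ->//|x y|y ->]; last by exists 0.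
  by rewrite !inE => -> ->.
by split; apply: bij0; rewrite ?subrr ?addr0.
Qed.

(** Zorn's lemma on partial mappings ordered by extension. Mappings are total functions of which
    only the values on the subgroup count, so extension is merely a preorder. *)
Lemma exists_maximal_scm (A : zmodType) (K : set A) :
  exists (H : set A) (theta : A -> A),
    [/\ is_subgroup H, scm_on H theta, forall x, H x -> K x -> x = 0 &
      forall H' theta', is_subgroup H' -> scm_on H' theta' ->
        (forall x, H' x -> K x -> x = 0) -> H `<=` H' ->
        (forall x, H x -> theta' x = theta x) -> H' `<=` H].
Proof.
pose ok (p : set A * (A -> A)) :=
  [/\ is_subgroup p.1, scm_on p.1 p.2 & forall x, p.1 x -> K x -> x = 0].
pose R (p q : {p | ok p}) :=
  `[< (sval p).1 `<=` (sval q).1 /\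
      forall x, (sval p).1 x -> (sval q).2 x = (sval p).2 x >].
have ok0 : ok ([set 0], id).
  split=> [||x //]; last exact: scm_on_set0.
  by split=> // x y -> ->; rewrite /= subrr.
have [p|p q r /asboolP[pq Epq] /asboolP[qr Eqr]|D Dtot|] :=
    @ZL_preorder _ (exist _ _ ok0) R.
- by apply/asboolP; split=> [x|].
- apply/asboolP; split=> [|x px]; first exact: subset_trans qr.
  by rewrite Eqr ?Epq //; apply: pq.
- have [D0|/set0P[p0 Dp0]] := eqVneq D set0.
    by exists (exist _ _ ok0) => s; rewrite D0.
  pose S (p : {p | ok p}) := (sval p).1; pose H := \bigcup_(p in D) S p.
  have Stot p q : D p -> D q -> S p `<=` S q \/ S q `<=` S p.
    by move=> Dp Dq; have [/asboolP[]|/asboolP[]] := Dtot p q Dp Dq; [left|right].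
  (* [u x] is a member of the chain containing [x], with [p0] as default off the union. Members of
     the chain agree on common points, so the choice is harmless. *)
  have /choice[u uP] x : exists p, H x -> D p /\ S p x.
    have [[p Dp px]|nHx] := pselect (H x); first by exists p.
    by exists p0.
  pose theta x := (sval (u x)).2 x.
  have theta_eq p x : D p -> S p x -> theta x = (sval p).2 x.
    move=> Dp px; have [|Du ux] := uP x; first by exists p.
    by have [/asboolP[_ /(_ x px)]|/asboolP[_ /(_ x ux)]] := Dtot p (u x) Dp Du.
  have scm_p p : D p -> scm_on (S p) theta.
    move=> Dp; have [_ scmp _] := svalP p.
    by apply: eq_scm_on scmp => x; apply: theta_eq.
  have okH : ok (H, theta).
    split=> /=; last by move=> x [p Dp px]; have [_ _] := svalP p; apply.
      split=> [|x y [p Dp px] [q Dq qy]].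
        by exists p0 => //; have [/subgroup0] := svalP p0.
      have [pq|qp] := Stot p q Dp Dq.
        exists q => //; have [subq _ _] := svalP q.
        by apply: (subgroupB subq) => //; apply: pq.
      exists p => //; have [subp _ _] := svalP p.
      by apply: (subgroupB subp) => //; apply: qp.
    by split; apply: (set_bij_chain_bigcup Stot) => p /scm_p[].
  exists (exist _ _ okH) => p Dp; apply/asboolP; split=> /=.
    by move=> x px; exists p.
  by move=> x px; apply: theta_eq.
- case=> -[H theta] [subH scmH HK] maxH; exists H, theta; split=> // H' theta'.
  move=> subH' scmH' HK' HH' Ett; have okH' : ok (H', theta') by [].
  have /maxH/asboolP[//] : R (exist _ _ (And3 subH scmH HK)) (exist _ _ okH').
  exact/asboolP.
Qed.

(** * Existence for all infinite abelian groups *)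

Lemma infinite_group_scm (A : zmodType) : infinite_set [set: A] ->
  exists theta : A -> A, scm_on setT theta.
Proof.
move=> infA; have subT : is_subgroup [set: A] by [].
have [K [_ subK cK infK]] := exists_countable_subgroup subT infA.
have [H [theta [subH scmH HK maxH]]] := exists_maximal_scm K.
have [Q [pi [pi_surj piH]]] := quotient_by_subgroup subH.
(* [K] meets [H] trivially, so it embeds in the quotient, which is therefore infinite. *)
have inj_pi x y : K x -> K y -> pi x = pi y -> x = y.
  move=> Kx Ky Exy; apply/eqP; rewrite -subr_eq0; apply/eqP/HK.
    by apply/piH; rewrite raddfB /= Exy subrr.
  exact: (subgroupB subK).
have [cQ|uncQ] := pselect (countable [set: Q]).
  have infQ : infinite_set [set: Q].
    move=> finQ; apply: infK; apply: (@finite_fibers _ _ _ pi) => [|q].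
      exact: sub_finite_set finQ.
    have [->|/set0P[x [Kx <-]]] := eqVneq (K `&` pi @^-1` [set q]) set0 => //.
    by apply: sub_finite_set (finite_set1 x) => y [Ky /inj_pi]; apply.
  have [//|phi scmQ] := @countable_subgroup_scm Q setT _ cQ infQ.
  have [//|theta' [scmA _]] := scm_on_extension piH pi_surj _ scmH scmQ.
  by exists theta'.
have cpiK : countable (pi @` K) by apply: sub_countable (card_image_le _ _) cK.
have [C [subC cC infC CK]] :=
  uncountable_disjoint_subgroup uncQ (subgroup_image subK pi) cpiK.
have [phi scmC] := countable_subgroup_scm subC cC infC.
have [theta' [scmA eqt]] := scm_on_extension piH pi_surj subC scmH scmC.
have CH : pi @^-1` C `<=` H.
  apply: maxH scmA _ _ eqt => [|x /= Cx Kx|x /piH Hx].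
  - split=> [|x y /= Cx Cy]; first by rewrite /= raddf0; apply: subgroup0.
    by rewrite raddfB; apply: (subgroupB subC).
  - by apply: HK => //; apply/piH/CK => //; exists x.
  - by rewrite /= Hx; apply: subgroup0.
case: infC; apply: sub_finite_set (finite_set1 0) => q Cq.
by have [x xq] := pi_surj q; rewrite -xq; apply/piH/CH; rewrite /= xq.
Qed.

Theorem theorem5p9 (A : zmodType) (A_infinite : infinite_set [set: A]) :
  ~ (finite_set [set: quotient_E2 A] /\
     has_nontrivial_cyclic_Sylow 3 (quotient_E2 A)) ->
  exists theta : A -> A, strong_complete_mapping theta.
Proof.
move=> _; have [theta [bij bijB bijD]] := infinite_group_scm A_infinite.
by exists theta; split; rewrite -setTT_bijective.
Qed.
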